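(* Let $A\subset B$ be an extension of commutative rings with unity and let $X$ be an indeterminate over $B$. Set $$\delta''_{(A,B)} := \sup\{\operatorname{ht}_{B[[X]]}(Q)\mid Q\in\operatorname{Spec}(B[[X]])\setminus V(X),\ (Q+XB[[X]])\cap A=\{0\}\}.$$ Then $$\max\{\dim(A)+1+\delta''_{(A,B)},\ 1+\dim(B[[X]][X^{-1}])\}\le \dim(A+XB[[X]])\le 1+\dim(A)+\dim(B[[X]][X^{-1}]).$$
   Context: $B[[X]]$ is the ring of formal power series over $B$, and $A+XB[[X]]$ is its subring consisting of the power series with constant term in $A$. $V(X)$ is the set of prime ideals of $B[[X]]$ containing $X$. $\dim$ is Krull dimension and $\operatorname{ht}$ is the height of a prime ideal. By convention, $\delta''_{(A,B)}=-1$ if the set defining it is empty. *)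

(* Defs.v *)
From HB Require Import structures.
From mathcomp Require Import all_boot all_order all_algebra.
From mathcomp Require Import generic_quotient ring_quotient ring zify.
From mathcomp Require Import boolp classical_sets constructive_ereal.

Set Implicit Arguments.
Unset Strict Implicit.
Unset Printing Implicit Defensive.

Import Order.TTheory GRing.Theory Num.Theory.

Local Open Scope classical_set_scope.
Local Open Scope quotient_scope.
Local Open Scope ring_scope.

(* [supremum] returns a genuine least upper bound in \bar int. *)
Lemma supremums_ereal_int (S : set (\bar int)) : supremums S !=set0.
Proof.
have [ubS|/existsNP[N NS]] := pselect (forall N : nat, exists2 x, S x & (N%:Z%:E <= x)%E).
  exists +oo%E; split=> [x _|y Sy]; first exact: leey.
  case: y Sy => [y|//|] Sy; last by have [x /Sy] := ubS 0%N; case: x.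
  have [x /Sy xy] := ubS `|y|.+1%N; move=> /le_trans /(_ xy).
  by rewrite lee_fin; lia.
have {}NS x : S x -> (x < N%:Z%:E)%E.
  by move=> Sx; rewrite ltNge; apply/negP => Nx; apply: NS; exists x.
have [[z Sz]|noS] := pselect (exists z : int, S z%:E); last first.
  exists -oo%E; split=> [|y _]; last exact: leNye.
  case=> [z Sz||//]; last by move=> /NS; rewrite ltNge leey.
  by case: noS; exists z.
have exm : exists m : nat, `[< S (N%:Z - m%:Z)%:E >].
  exists `|N%:Z - z|%N; apply/asboolP.
  have := NS _ Sz; rewrite lte_fin => zN.
  by rewrite (_ : N%:Z - _ = z) //; lia.
have [m /asboolP Sm min_m] := ex_minnP exm.
exists (N%:Z - m%:Z)%:E; split=> [|y]; last exact.
case=> [x Sx||_]; [|by move=> /NS; rewrite ltNge leey|exact: leNye].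
have := NS _ Sx; rewrite lte_fin lee_fin => xN.
rewrite leNgt; apply/negP => mx.
have /min_m : `[< S (N%:Z - `|N%:Z - x|%N%:Z)%:E >].
  by apply/asboolP; rewrite (_ : N%:Z - _ = x) //; lia.
lia.
Qed.

(* A chain P 0, ..., P n of length n; the values P i with i > n are junk. *)
Definition prime_chain (R : comNzRingType) (P : nat -> prime_idealr R) (n : nat) :=
  forall i, (i < n)%N ->
    {subset P i <= P i.+1} /\ ~ {subset P i.+1 <= P i}.

Definition krull_dim (R : comNzRingType) : \bar int :=
  supremum -oo%E [set (n%:Z)%:E | n in
    [set n | exists P : nat -> prime_idealr R, prime_chain P n]].

Definition height (R : comNzRingType) (Q : prime_idealr R) : \bar int :=
  supremum -oo%E [set (n%:Z)%:E | n in
    [set n | exists2 P : nat -> prime_idealr R, prime_chain P n & P n =i Q]].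

Section Subring.
Variables (R : comNzRingType) (S : subringClosed R).

Definition subring_of := {x : R | x \in S}.

HB.instance Definition _ := [isSub of subring_of for @sval R (fun x => x \in S)].
HB.instance Definition _ := [Choice of subring_of by <:].
HB.instance Definition _ := [SubChoice_isSubComNzRing of subring_of by <:].

End Subring.

Record fps (B : Type) := Fps { fps_coef : nat -> B }.
Add Printing Constructor fps.
Arguments fps_coef {B}.

Section FpsRing.
Variable B : comNzRingType.
Implicit Types f g h : fps B.

HB.instance Definition _ := [isNew for @fps_coef B].
HB.instance Definition _ := [Choice of fps B by <:].

Lemma fpsP f g : (forall n, fps_coef f n = fps_coef g n) <-> f = g.
Proof.
by split=> [fg|->//]; apply/val_inj/funext.
Qed.

Definition fpsC (b : B) := Fps (fun n => if n == 0%N then b else 0).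
Definition fpsX : fps B := Fps (fun n => (n == 1%N)%:R).
Definition fps_opp f := Fps (fun n => - fps_coef f n).
Definition fps_add f g := Fps (fun n => fps_coef f n + fps_coef g n).
Definition fps_mul f g :=
  Fps (fun n => \sum_(i < n.+1) fps_coef f i * fps_coef g (n - i)%N).

Fact fps_addA : associative fps_add.
Proof. by move=> f g h; apply/fpsP => n /=; rewrite addrA. Qed.
Fact fps_addC : commutative fps_add.
Proof. by move=> f g; apply/fpsP => n /=; rewrite addrC. Qed.
Fact fps_add0 : left_id (fpsC 0) fps_add.
Proof. by move=> f; apply/fpsP => n /=; rewrite if_same add0r. Qed.
Fact fps_addN : left_inverse (fpsC 0) fps_opp fps_add.
Proof. by move=> f; apply/fpsP => n /=; rewrite addNr if_same. Qed.

HB.instance Definition _ :=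
  GRing.isZmodule.Build (fps B) fps_addA fps_addC fps_add0 fps_addN.

(* Ring axioms are transferred from {poly B} through truncations. *)
Let trunc N f : {poly B} := \poly_(i < N) fps_coef f i.

Let coef_trunc N f n : (n < N)%N -> (trunc N f)`_n = fps_coef f n.
Proof. by move=> nN; rewrite coef_poly nN. Qed.

Let coef_truncM N f g n : (n < N)%N ->
  (trunc N f * trunc N g)`_n = fps_coef (fps_mul f g) n.
Proof.
move=> nN; rewrite coefM; apply: eq_bigr => i _.
by rewrite !coef_trunc ?(leq_ltn_trans _ nN) ?leq_subr // -ltnS.
Qed.

Fact fps_mulC : commutative fps_mul.
Proof.
by move=> f g; apply/fpsP => n; rewrite -!(coef_truncM _ _ (ltnSn n)) mulrC.
Qed.

Fact fps_mulA : associative fps_mul.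
Proof.
move=> f g h; apply/fpsP => n.
pose t := trunc n.+1.
have -> : fps_coef (fps_mul f (fps_mul g h)) n = (t f * (t g * t h))`_n.
  rewrite coefM; apply: eq_bigr => i _.
  by rewrite coef_trunc // coef_truncM // ltnS leq_subr.
have -> : fps_coef (fps_mul (fps_mul f g) h) n = (t f * t g * t h)`_n.
  rewrite coefM; apply: eq_bigr => i _.
  by rewrite coef_truncM // coef_trunc // ltnS leq_subr.
by rewrite mulrA.
Qed.

Fact fps_mul1 : left_id (fpsC 1) fps_mul.
Proof.
move=> f; apply/fpsP => n /=; rewrite big_ord_recl /= mul1r subn0.
by rewrite big1 ?addr0 // => i _; rewrite mul0r.
Qed.

Fact fps_mulDl : left_distributive fps_mul fps_add.
Proof.
move=> f g h; apply/fpsP => n /=; rewrite -big_split /=.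
by apply: eq_bigr => i _; rewrite mulrDl.
Qed.

Fact fps_oner_neq0 : fpsC 1 != 0.
Proof. by apply/eqP => /fpsP /(_ 0%N) /eqP; rewrite /= oner_eq0. Qed.

HB.instance Definition _ := GRing.Zmodule_isComNzRing.Build (fps B)
  fps_mulA fps_mulC fps_mul1 fps_mulDl fps_oner_neq0.

End FpsRing.

Arguments fpsX {B}.
Notation "{ 'fps' B }" := (fps B) (format "{ 'fps'  B }") : type_scope.

Lemma fps_coefXM (B : comNzRingType) (f : {fps B}) n :
  fps_coef (fpsX * f) n = if n is m.+1 then fps_coef f m else 0.
Proof.
rewrite /GRing.mul /=; case: n => [|n].
  by rewrite big_ord_recl big_ord0 /= mul0r addr0.
rewrite big_ord_recl /= mul0r add0r big_ord_recl /= mul1r subSS subn0.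
by rewrite big1 ?addr0 // => i _; rewrite mul0r.
Qed.

Lemma fpsXI (B : comNzRingType) : injective ( *%R (@fpsX B)).
Proof.
move=> f g /fpsP fg; apply/fpsP => n.
by have := fg n.+1; rewrite !fps_coefXM.
Qed.

(* A + XB[[X]] *)
Section FpsOver.
Variables (B : comNzRingType) (A : subringClosed B).

Definition fps_const_in : {pred {fps B}} := fun f => fps_coef f 0%N \in A.

Lemma fps_const_inE f : (f \in fps_const_in) = (fps_coef f 0%N \in A).
Proof. by []. Qed.

Fact fps_const_in_subring : subring_closed fps_const_in.
Proof.
split=> [|f g|f g]; rewrite !fps_const_inE /=; first exact: rpred1.
  exact: rpredB.
by move=> fA gA; rewrite big_ord_recl big_ord0 addr0 rpredM.
Qed.

HB.instance Definition _ :=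
  GRing.isSubringClosed.Build {fps B} fps_const_in fps_const_in_subring.

End FpsOver.

(* The ring of fractions R[s^-1], where (a, n) stands for a / s ^ n. *)
Section Localization.
Variables (R : comNzRingType) (s : R).
Implicit Types x y z : R * nat.

Definition loc_equiv x y : bool :=
  `[< exists k, s ^+ k * (s ^+ y.2 * x.1) = s ^+ k * (s ^+ x.2 * y.1) >].

Fact loc_equiv_refl : reflexive loc_equiv.
Proof. by move=> x; apply/asboolP; exists 0%N. Qed.

Fact loc_equiv_sym : symmetric loc_equiv.
Proof. by move=> x y; apply/asboolP/asboolP => -[k e]; exists k. Qed.

Fact loc_equiv_trans : transitive loc_equiv.
Proof.
move=> y x z /asboolP[k e] /asboolP[l e']; apply/asboolP.
exists (k + l + y.2)%N; rewrite !exprD.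
transitivity (s ^+ l * s ^+ z.2 * (s ^+ k * (s ^+ y.2 * x.1))); first by ring.
rewrite e.
transitivity (s ^+ k * s ^+ x.2 * (s ^+ l * (s ^+ z.2 * y.1))); first by ring.
by rewrite e'; ring.
Qed.

Canonical loc_equiv_rel :=
  EquivRel loc_equiv loc_equiv_refl loc_equiv_sym loc_equiv_trans.

Definition localization := {eq_quot loc_equiv}.

HB.instance Definition _ : EqQuotient _ loc_equiv localization :=
  EqQuotient.on localization.
HB.instance Definition _ := Choice.on localization.

Lemma loc_eqP x y :
  reflect (exists k, s ^+ k * (s ^+ y.2 * x.1) = s ^+ k * (s ^+ x.2 * y.1))
          (x == y %[mod localization]).
Proof. by rewrite eqmodE; exact: asboolP. Qed.

Let loc_eq x y : s ^+ y.2 * x.1 = s ^+ x.2 * y.1 -> \pi_localization x = \pi y.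
Proof. by move=> e; apply/eqP/loc_eqP; exists 0%N; rewrite e. Qed.

Let oppf x := (- x.1, x.2).
Let addf x y := (s ^+ y.2 * x.1 + s ^+ x.2 * y.1, (x.2 + y.2)%N).
Let mulf x y := (x.1 * y.1, (x.2 + y.2)%N).

Definition loc_zero : localization := \pi_localization (0, 0%N).
Definition loc_one : localization := \pi_localization (1, 0%N).
Definition loc_opp (u : localization) : localization :=
  \pi_localization (oppf (repr u)).
Definition loc_add (u v : localization) : localization :=
  \pi_localization (addf (repr u) (repr v)).
Definition loc_mul (u v : localization) : localization :=
  \pi_localization (mulf (repr u) (repr v)).

Let reprP x : exists k, s ^+ k * (s ^+ x.2 * (repr (\pi_localization x)).1) =
                        s ^+ k * (s ^+ (repr (\pi_localization x)).2 * x.1).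
Proof. by apply/loc_eqP; rewrite reprK. Qed.

Lemma pi_loc_opp x : loc_opp (\pi_localization x) = \pi_localization (- x.1, x.2).
Proof.
apply/eqP/loc_eqP; have [k e] := reprP x; exists k => /=.
by rewrite !mulrN e.
Qed.

Lemma pi_loc_add x y : loc_add (\pi_localization x) (\pi_localization y) =
  \pi_localization (s ^+ y.2 * x.1 + s ^+ x.2 * y.1, (x.2 + y.2)%N).
Proof.
apply/eqP/loc_eqP; have [k e] := reprP x; have [l e'] := reprP y.
exists (k + l)%N => /=; move: e e'.
move: (repr (\pi_localization x)) (repr (\pi_localization y)) => u v e e'.
rewrite !exprD.
transitivity (s ^+ y.2 * s ^+ v.2 * s ^+ l * (s ^+ k * (s ^+ x.2 * u.1)) +
  s ^+ x.2 * s ^+ u.2 * s ^+ k * (s ^+ l * (s ^+ y.2 * v.1))); first by ring.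
by rewrite e e'; ring.
Qed.

Lemma pi_loc_mul x y : loc_mul (\pi_localization x) (\pi_localization y) =
  \pi_localization (x.1 * y.1, (x.2 + y.2)%N).
Proof.
apply/eqP/loc_eqP; have [k e] := reprP x; have [l e'] := reprP y.
exists (k + l)%N => /=; move: e e'.
move: (repr (\pi_localization x)) (repr (\pi_localization y)) => u v e e'.
rewrite !exprD.
transitivity ((s ^+ k * (s ^+ x.2 * u.1)) * (s ^+ l * (s ^+ y.2 * v.1))).
  by ring.
by rewrite e e'; ring.
Qed.

Fact loc_addA : associative loc_add.
Proof.
elim/quotW=> x; elim/quotW=> y; elim/quotW=> z.
by rewrite (pi_loc_add y) (pi_loc_add x y) !pi_loc_add; apply: loc_eq; rewrite /= !exprD; ring.
Qed.

Fact loc_addC : commutative loc_add.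
Proof.
elim/quotW=> x; elim/quotW=> y.
by rewrite !pi_loc_add; apply: loc_eq; rewrite /= !exprD; ring.
Qed.

Fact loc_add0 : left_id loc_zero loc_add.
Proof.
elim/quotW=> x; rewrite /loc_zero pi_loc_add.
by apply: loc_eq; rewrite /= !exprD expr0; ring.
Qed.

Fact loc_addN : left_inverse loc_zero loc_opp loc_add.
Proof.
elim/quotW=> x; rewrite /loc_zero pi_loc_opp pi_loc_add.
by apply: loc_eq; rewrite /= !exprD expr0; ring.
Qed.

Fact loc_mulA : associative loc_mul.
Proof.
elim/quotW=> x; elim/quotW=> y; elim/quotW=> z.
by rewrite (pi_loc_mul y) (pi_loc_mul x y) !pi_loc_mul; apply: loc_eq; rewrite /= !exprD; ring.
Qed.

Fact loc_mulC : commutative loc_mul.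
Proof.
elim/quotW=> x; elim/quotW=> y.
by rewrite !pi_loc_mul; apply: loc_eq; rewrite /= !exprD; ring.
Qed.

Fact loc_mul1 : left_id loc_one loc_mul.
Proof.
elim/quotW=> x; rewrite /loc_one pi_loc_mul.
by apply: loc_eq; rewrite /= !exprD expr0; ring.
Qed.

Fact loc_mulDl : left_distributive loc_mul loc_add.
Proof.
elim/quotW=> x; elim/quotW=> y; elim/quotW=> z.
rewrite (pi_loc_add x) (pi_loc_mul x) (pi_loc_mul y) !pi_loc_add pi_loc_mul.
by apply: loc_eq; rewrite /= !exprD; ring.
Qed.

HB.instance Definition _ := GRing.isZmodule.Build localization
  loc_addA loc_addC loc_add0 loc_addN.
HB.instance Definition _ := GRing.Zmodule_isComPzRing.Build localization
  loc_mulA loc_mulC loc_mul1 loc_mulDl.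

End Localization.

(* B[[X]][X^-1] *)
Definition fps_Xinv (B : comNzRingType) := localization (@fpsX B).

Section FpsXinv.
Variable B : comNzRingType.

HB.instance Definition _ := GRing.ComPzRing.on (fps_Xinv B).

Fact fps_Xinv_oner_neq0 : 1 != 0 :> fps_Xinv B.
Proof.
apply/negP => /loc_eqP[k] /=; rewrite !expr0 !mul1r mulr0.
elim: k => [/eqP|k IHk]; first by rewrite mul1r oner_eq0.
by rewrite exprS -mulrA -[RHS](mulr0 fpsX) => /fpsXI.
Qed.

HB.instance Definition _ :=
  GRing.PzSemiRing_isNonZero.Build (fps_Xinv B) fps_Xinv_oner_neq0.

End FpsXinv.

Definition in_VX (B : comNzRingType) (Q : prime_idealr {fps B}) : Prop :=
  fpsX \in Q.

(* The ideal Q + XB[[X]] of B[[X]]. *)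
Definition addX (B : comNzRingType) (Q : prime_idealr {fps B}) : set {fps B} :=
  [set q + fpsX * g | q in [set` Q] & g in [set: {fps B}]].

(* A is seen inside B[[X]] through constant power series. *)
Definition delta''_set (B : comNzRingType) (A : subringClosed B) :
    set (\bar int) :=
  [set h | exists Q : prime_idealr {fps B},
    [/\ ~ in_VX Q,
        addX Q `&` [set fpsC a | a in [set` A]] = [set 0]
      & h = height Q]].

Definition delta'' (B : comNzRingType) (A : subringClosed B) : \bar int :=
  if delta''_set A == set0 then (-1)%:E else supremum -oo%E (delta''_set A).

(* Main.v *)
(* Let R = A + XB[[X]]. A prime of R containing X contains XB[[X]], so it comes
   from a prime of A = R / XB[[X]]; a prime of R not containing X comes from a
   prime of R[X^-1] = B[[X]][X^-1]. Cutting a chain of R at the first prime that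
   contains X gives the upper bound. For the lower bounds, chains are glued:
   - a prime P of R without X is never maximal, because its elements with
     constant term 1 would be units, so its constant terms generate a proper
     ideal of A, and P lies strictly below a prime containing X;
   - if (Q + XB[[X]]) meets A in 0, then the contraction of Q to R lies in
     XB[[X]], below every prime coming from A. *)
Require Import Defs.
From HB Require Import structures.
From mathcomp Require Import all_boot all_order all_algebra.
From mathcomp Require Import generic_quotient ring_quotient ring zify.
From mathcomp Require Import boolp classical_sets constructive_ereal.

Set Implicit Arguments.
Unset Strict Implicit.
Unset Printing Implicit Defensive.

Import Order.TTheory GRing.Theory Num.Theory.

Local Open Scope quotient_scope.
Local Open Scope ring_scope.

(** * Prime ideals, chains and Krull dimension *)

Section PrimeIdeals.
Variable R : comNzRingType.
Implicit Types (P : prime_idealr R) (x y : R).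

Lemma prime_idealr_of_pred (I : R -> bool) :
  I 0 -> I 1 = false -> (forall a x y, I x -> I y -> I (a * x + y)) ->
  (forall x y, I (x * y) -> I x || I y) ->
  exists P : prime_idealr R, forall x, (x \in P) = I x.
Proof.
move=> I0 I1 ID IM; have idI : idealr_closed I by split; rewrite // /in_mem /= I1.
pose m1 := isIdealr.Build R I idI.
pose m2 := isPrimeIdealrClosed.Build R I IM.
pose P : prime_idealr R := HB.pack I m1 m2.
by exists P.
Qed.

(** By Zorn's lemma there is an ideal maximal among the proper ones containing [J], and such an
    ideal is prime. *)
Lemma exists_prime_idealr_sub (J : set R) :
  J 0 -> ~ J 1 -> (forall a x y, J x -> J y -> J (a * x + y)) ->
  exists P : prime_idealr R, forall x, J x -> x \in P.
Proof.
move=> J0 J1 JD.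
pose proper (I : set R) :=
  ~ I 1 /\ forall a x y, I x -> I y -> I (a * x + y).
(* Adding J to the sets of the chain makes the empty chain harmless. *)
have [F Fproper totF|I [[M1 MD] Mmax]] :=
    @Zorn_bigcup R [set I | proper (I `|` J)%classic].
  split=> [[[I FI I1]|//]|a x y].
    by case: (Fproper _ FI) => + _; apply; left.
  have inF I z : F I -> (I `|` J)%classic z ->
      (\bigcup_(X in F) X `|` J)%classic z.
    by move=> FI [Iz|Jz]; [left; exists I|right].
  move=> [[I FI Ix]|Jx] [[I' FI' Iy]|Jy].
  - have [II'|I'I] := totF _ _ FI FI'.
      apply: (inF I') => //; case: (Fproper _ FI') => _; apply; left=> //.
      exact: II'.
    apply: (inF I) => //; case: (Fproper _ FI) => _; apply; left=> //.
    exact: I'I.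
  - by apply: (inF I) => //; case: (Fproper _ FI) => _; apply; [left|right].
  - by apply: (inF I') => //; case: (Fproper _ FI') => _; apply; [right|left].
  - by right; apply: JD.
pose M : {pred R} := fun x => `[< (I `|` J)%classic x >].
have ME x : reflect ((I `|` J)%classic x) (x \in M) by apply: (iffP (asboolP _)).
have M0 : 0 \in M by apply/ME; right.
have {}MD a : {in M &, forall x y, a * x + y \in M}.
  by move=> x y /ME Mx /ME My; apply/ME; apply: MD.
have MM a x : x \in M -> a * x \in M by move=> Mx; rewrite -[_ * _]addr0 MD.
have [||||P PE] := @prime_idealr_of_pred (fun x => x \in M); last first.
- by exists P => x Jx; rewrite PE; apply/ME; right.
- move=> x y Mxy; apply/orP; have [|nMx] := boolP (x \in M); [by left|right].
  (* If 1 = rx + m, then y = r(xy) + my lies in [M]. Otherwise M + Rx is proper, and maximality puts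
     x in [M], a contradiction. *)
  have [[m Mm [r e]]|nM1] := pselect (exists2 m, m \in M & exists r, 1 = r * x + m).
    by rewrite -[y]mul1r e mulrDl -mulrA MD // mulrC MM.
  pose N : set R := [set z | exists2 m, m \in M & exists r, z = r * x + m]%classic.
  have MN z : (I `|` J)%classic z -> N z.
    by move=> /ME Mz; exists z => //; exists 0; rewrite mul0r add0r.
  case: (Mmax N).
    split=> [z Iz|NI]; first by apply: MN; left.
    case/ME: nMx; left; apply: NI.
    by exists 0 => //; exists 1; rewrite mul1r addr0.
  rewrite /= (_ : (N `|` J)%classic = N); last first.
    by apply/seteqP; split=> z; [case=> [//|Jz]; apply: MN; right|left].
  split=> // a _ _ [m Mm [r ->]] [m' Mm' [r' ->]].
  by exists (a * m + m'); [exact: MD|exists (a * r + r'); ring].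
- exact: MD.
- by apply/negP => /ME.
- exact: M0.
Qed.

Lemma prime_chain_subset (P : nat -> prime_idealr R) n i j :
  prime_chain P n -> (i <= j <= n)%N -> {subset P i <= P j}.
Proof.
move=> cP /andP[]; elim: j => [|j IHj]; first by rewrite leqn0 => /eqP-> _ x.
rewrite leq_eqVlt => /orP[/eqP->|ij] jn x Pix //.
by have [PP _] := cP _ jn; apply/PP/(IHj ij (ltnW jn)).
Qed.

(** The strict inclusion joining the two chains is itself a step, hence the successor in the
    length. *)
Lemma prime_chain_cat (P P' : nat -> prime_idealr R) m n :
  prime_chain P m -> prime_chain P' n ->
  {subset P m <= P' 0} -> ~ {subset P' 0 <= P m} ->
  exists P'' : nat -> prime_idealr R, prime_chain P'' (m + n).+1.
Proof.
move=> cP cP' sub nsub.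
exists (fun i => if (i <= m)%N then P i else P' (i - m.+1)%N) => i imn.
case: (ltngtP i m) => im.
- exact: cP.
- rewrite (subSn im); apply: cP'; lia.
- by rewrite im subnn.
Qed.

Lemma le_krull_dim (P : nat -> prime_idealr R) n :
  prime_chain P n -> (n%:Z%:E <= krull_dim R)%E.
Proof.
move=> cP; apply: ge_supremum_Nmem; first exact: supremums_ereal_int.
by exists n => //; exists P.
Qed.

End PrimeIdeals.

Lemma supremum_ereal_int_le (S : set (\bar int)) (d : \bar int) :
  (forall x, S x -> (x <= d)%E) -> (supremum -oo%E S <= d)%E.
Proof.
(* Both defaults, for an empty set and for a missing supremum, are -oo, which is below every [d]. *)
move=> Sd; rewrite /supremum; case: ifPn => _; first exact: leNye.
by case: xgetP => [x _ [_]|_]; [apply|rewrite leNye].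
Qed.

Lemma krull_dim_le (R : comNzRingType) (d : \bar int) :
  (forall n (P : nat -> prime_idealr R), prime_chain P n -> (n%:Z%:E <= d)%E) ->
  (krull_dim R <= d)%E.
Proof.
by move=> Rd; apply: supremum_ereal_int_le => _ [n [P cP] <-]; apply: Rd cP.
Qed.

Lemma exists_prime_idealr (R : comNzRingType) : exists P : prime_idealr R, True.
Proof.
have [|||P _] := @exists_prime_idealr_sub R [set 0]%classic; last by exists P.
- by [].
- by move/eqP; rewrite oner_eq0.
- by move=> a _ _ -> ->; rewrite mulr0 addr0.
Qed.

Lemma prime_chain0 (R : comNzRingType) (P : nat -> prime_idealr R) :
  prime_chain P 0.
Proof. by []. Qed.

Lemma krull_dim_ge0 (R : comNzRingType) : (0 <= krull_dim R)%E.
Proof.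
by have [P _] := exists_prime_idealr R; apply: (le_krull_dim (@prime_chain0 _ (fun=> P))).
Qed.

(** A correspondence that preserves and reflects inclusion carries strict inclusions to strict ones.
    The window from [k] to [k + m] serves chains of which only a segment has counterparts in [S]. *)
Lemma prime_chain_transfer (R S : comNzRingType)
    (rel : prime_idealr R -> prime_idealr S -> Prop)
    (P : nat -> prime_idealr R) n k m :
  (forall P P' Q Q', rel P Q -> rel P' Q' ->
    {subset P <= P'} <-> {subset Q <= Q'}) ->
  prime_chain P n -> (k + m <= n)%N ->
  (forall i, (k <= i <= k + m)%N -> exists Q, rel (P i) Q) ->
  exists2 Q, prime_chain Q m & forall i, (i <= m)%N -> rel (P (k + i)%N) (Q i).
Proof.
move=> relE cP kmn exQ.
have /choice[Q relQ] : forall i, exists Q, (i <= m)%N -> rel (P (k + i)%N) Q.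
  move=> i; have [im|_] := leqP i m; last first.
    (* Junk value beyond the end of the chain. *)
    by have [Q _] := exists_prime_idealr S; exists Q.
  have [|Q relQ] := exQ (k + i)%N; first by rewrite leq_addr leq_add2l.
  by exists Q.
exists Q => // i im; have [|sub nsub] := cP (k + i)%N; first by lia.
have rQ := relQ _ (ltnW im); have rQ' := relQ _ im; rewrite addnS in rQ'.
split; first exact/(relE _ _ _ _ rQ rQ').
by move/(relE _ _ _ _ rQ' rQ).
Qed.

(** * Inverses of power series with constant term 1 *)

Section PowerSeries.
Variable B : comNzRingType.
Implicit Types f g u : {fps B}.

Lemma fps_coefB f g n : fps_coef (f - g) n = fps_coef f n - fps_coef g n.
Proof. by []. Qed.

Lemma fps_coefM f g n :
  fps_coef (f * g) n = \sum_(i < n.+1) fps_coef f i * fps_coef g (n - i)%N.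
Proof. by []. Qed.

Lemma fps_coefXM_exp g k n : (n < k)%N -> fps_coef ((fpsX * g) ^+ k) n = 0.
Proof.
elim: k n => // k IHk n nk; rewrite exprS -mulrA fps_coefXM.
case: n nk => // n nk; rewrite fps_coefM big1 // => i _.
by rewrite IHk ?mulr0 // (leq_ltn_trans (leq_subr _ _)).
Qed.

(* The inverse is the geometric series, convergent for the X-adic topology. *)
Lemma fps_subXM_inv g : exists h, (1 - fpsX * g) * h = 1.
Proof.
pose u := fpsX * g; pose geo N := \sum_(k < N) u ^+ k.
have coef_geo N n : (n < N)%N -> fps_coef (geo N) n = fps_coef (geo n.+1) n.
  elim: N => // N IHN; rewrite ltnS leq_eqVlt => /orP[/eqP->//|nN].
  rewrite -(IHN nN) /geo big_ord_recr; apply/eqP.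
  by rewrite -subr_eq0 -fps_coefB addrC addKr fps_coefXM_exp.
exists (Fps (fun n => fps_coef (geo n.+1) n)); apply/fpsP => n.
transitivity (fps_coef ((1 - u) * geo n.+1) n).
  rewrite !fps_coefM; apply: eq_bigr => i _ /=; congr (_ * _).
  by rewrite (coef_geo n.+1) // ltnS leq_subr.
by rewrite -[1 - u]opprB mulNr -subrX1 opprB fps_coefB fps_coefXM_exp ?subr0.
Qed.

End PowerSeries.

(** * Primes of A + XB[[X]] compared with primes of A, of B[[X]][X^-1] and of B[[X]] *)

Section ConstantTermInSubring.
Variables (B : comNzRingType) (A : subringClosed B).
Local Notation R := (subring_of (fps_const_in A)).
Local Notation L := (fps_Xinv B).
Local Notation frac g n := (\pi_L%qT (g, n) : L).
Implicit Types (f : R) (g : {fps B}) (a : subring_of A).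
Implicit Types (P : prime_idealr R) (Q : prime_idealr {fps B}).

Definition const_term f : subring_of A := Sub (fps_coef (val f) 0%N) (valP f).

Fact fpsC_const_in a : fpsC (val a) \in fps_const_in A.
Proof. exact: valP a. Qed.
Definition const_fps a : R := Sub (fpsC (val a)) (fpsC_const_in a).

Fact fpsXM_const_in g : fpsX * g \in fps_const_in A.
Proof. by rewrite fps_const_inE fps_coefXM rpred0. Qed.
(** A series [g] over B need not lie in A + XB[[X]], but Xg always does. In particular [shift 1] is
    X as an element of this ring. *)
Definition shift g : R := Sub (fpsX * g) (fpsXM_const_in g).

Lemma const_term1 : const_term 1 = 1.
Proof. exact: val_inj. Qed.

Lemma const_termD : {morph const_term : f f' / f + f'}.
Proof. by move=> f f'; apply: val_inj. Qed.

Lemma const_termM : {morph const_term : f f' / f * f'}.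
Proof.
move=> f f'; apply: val_inj.
by rewrite /= big_ord_recl big_ord0 addr0.
Qed.

Lemma const_fps0 : const_fps 0 = 0.
Proof. by apply/val_inj/fpsP => -[]. Qed.

Lemma const_fps1 : const_fps 1 = 1.
Proof. by apply/val_inj/fpsP => -[]. Qed.

Lemma const_fpsD : {morph const_fps : a a' / a + a'}.
Proof. by move=> a a'; apply/val_inj/fpsP => -[|n] //=; rewrite addr0. Qed.

Lemma const_fpsM : {morph const_fps : a a' / a * a'}.
Proof.
move=> a a'; apply/val_inj/fpsP => n /=.
rewrite big_ord_recl big1 ?addr0 => [|i _]; last by rewrite mul0r.
by case: n => //= n; rewrite mulr0.
Qed.

Lemma const_fpsK : cancel const_fps const_term.
Proof. by move=> a; apply: val_inj. Qed.

Lemma const_term_shift g : const_term (shift g) = 0.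
Proof. by apply: val_inj; exact: (fps_coefXM g 0). Qed.

Lemma shift_const_term f : exists g, f = const_fps (const_term f) + shift g.
Proof.
exists (Fps (fun n => fps_coef (val f) n.+1)); apply/val_inj/fpsP => n.
transitivity (fps_coef (fpsC (fps_coef (val f) 0)) n +
  fps_coef (fpsX * Fps (fun n => fps_coef (val f) n.+1)) n) => //.
by rewrite fps_coefXM; case: n => [|n] /=; rewrite ?addr0 ?add0r.
Qed.

Lemma shift0 : shift 0 = 0.
Proof. by apply: val_inj; rewrite /= mulr0. Qed.

Lemma shiftD : {morph shift : g g' / g + g'}.
Proof. by move=> g g'; apply: val_inj; rewrite /= mulrDr. Qed.

Lemma shiftM g g' : shift g * shift g' = shift 1 * shift (g * g').
Proof. by apply: val_inj; rewrite /= mulr1; ring. Qed.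

Lemma shiftMl f g : f * shift g = shift (val f * g).
Proof. by apply: val_inj; rewrite /=; ring. Qed.

Lemma shift1M f : shift 1 * f = shift (val f).
Proof. by apply: val_inj; rewrite /= mulr1. Qed.

(* X \in P forces XB[[X]] \subset P since (Xg)^2 = X * (Xg^2). *)
Lemma shift_in_prime P g : shift 1 \in P -> shift g \in P.
Proof.
move=> P1; have : shift g * shift g \in P by rewrite shiftM prime_idealrM P1.
by rewrite prime_idealrM orbb.
Qed.

(** A relation rather than a map, so that chains can be moved along it in both directions. *)
Definition const_contraction P (p : prime_idealr (subring_of A)) :=
  forall f, (f \in P) = (const_term f \in p).

Lemma const_contraction_subset P P' p p' :
  const_contraction P p -> const_contraction P' p' ->
  {subset P <= P'} <-> {subset p <= p'}.
Proof.
move=> Pp Pp'; split=> sub => [a|f]; last by rewrite Pp Pp'; apply: sub.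
by rewrite -[a]const_fpsK -Pp -Pp'; apply: sub.
Qed.

Lemma const_contraction_ex p : exists P, const_contraction P p.
Proof.
have [||||P PE] := @prime_idealr_of_pred R (fun f => const_term f \in p).
- by rewrite -const_fps0 const_fpsK rpred0.
- by rewrite const_term1 idealr1.
- by move=> f u v pu pv; rewrite const_termD const_termM rpredD ?idealMr.
- by move=> f f'; rewrite const_termM prime_idealrM.
- by exists P.
Qed.

(** Once XB[[X]] lies in [P], membership in [P] depends on the constant term alone. *)
Lemma const_extension_ex P : shift 1 \in P -> exists p, const_contraction P p.
Proof.
move=> PX.
have [||||p pE] := @prime_idealr_of_pred _ (fun a => const_fps a \in P).
- by rewrite const_fps0 rpred0.
- by rewrite const_fps1 idealr1.
- by move=> f u v pu pv; rewrite const_fpsD const_fpsM rpredD ?idealMr.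
- by move=> f f'; rewrite const_fpsM prime_idealrM.
- exists p => f; rewrite pE; have [g {1}->] := shift_const_term f.
  by apply: rpredDr; exact: shift_in_prime.
Qed.

(** Since X is a unit of B[[X]][X^-1], the fraction can be tested on Xg, which lies in A + XB[[X]]
    even when g does not. Taking g = 1 shows that such a [P] avoids X. *)
Definition loc_contraction P (q : prime_idealr L) :=
  forall g n, (frac g n \in q) = (shift g \in P).

Lemma frac1 : frac 1 0 = 1.
Proof. by []. Qed.

Lemma fracM g g' n n' : frac g n * frac g' n' = frac (g * g') (n + n').
Proof. exact: pi_loc_mul. Qed.

Lemma fracD g g' n n' :
  frac g n + frac g' n' = frac (fpsX ^+ n' * g + fpsX ^+ n * g') (n + n').
Proof. exact: pi_loc_add. Qed.

Lemma frac_eq g g' n n' :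
  fpsX ^+ n' * g = fpsX ^+ n * g' -> frac g n = frac g' n'.
Proof. by move=> e; apply/eqP/loc_eqP; exists 0%N; rewrite e. Qed.

Lemma frac0 n : frac 0 n = 0.
Proof. by apply: frac_eq; rewrite !mulr0. Qed.

Lemma frac_mem (q : prime_idealr L) g n n' : (frac g n \in q) = (frac g n' \in q).
Proof.
suff: forall k l, frac g k \in q -> frac g l \in q by move=> h; apply/idP/idP; apply: h.
move=> k l qk; have -> : frac g l = frac (fpsX ^+ k) l * frac g k.
  by rewrite fracM; apply: frac_eq; rewrite exprD; ring.
exact: idealMr.
Qed.

Lemma mem_loc_contraction P q f :
  loc_contraction P q -> (f \in P) = (frac (val f) 0 \in q).
Proof.
move=> Pq; rewrite Pq -shift1M prime_idealrM.
by rewrite -(Pq 1 0%N) frac1 idealr1.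
Qed.

Lemma loc_contraction_subset P P' q q' :
  loc_contraction P q -> loc_contraction P' q' ->
  {subset P <= P'} <-> {subset q <= q'}.
Proof.
move=> Pq Pq'; split=> sub => [|f]; last first.
  by rewrite (mem_loc_contraction f Pq) (mem_loc_contraction f Pq'); apply: sub.
by elim/quotW => -[g n]; rewrite Pq Pq'; apply: sub.
Qed.

Lemma loc_contraction_ex q : exists P, loc_contraction P q.
Proof.
have [||||P PE] := @prime_idealr_of_pred R (fun f => frac (val f) 0 \in q).
- by rewrite frac0 rpred0.
- by rewrite frac1 idealr1.
- move=> f u v qu qv.
    have -> : frac (val (f * u + v)) 0 = frac (val f) 0 * frac (val u) 0 + frac (val v) 0.
      by rewrite fracM fracD expr0 !mul1r.
    by rewrite rpredD ?idealMr.
- move=> f f'; rewrite -prime_idealrM fracM; exact.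
- exists P => g n; rewrite PE.
  have -> : frac (val (shift g)) 0 = frac fpsX 0 * frac g 0 by rewrite fracM.
  rewrite prime_idealrM (frac_mem q g n 0) [X in X || _](_ : _ = false) //.
  (* X / X = 1, so X is a unit and lies in no prime [q]. *)
  rewrite (frac_mem q _ 0 1) -(idealr1 q); congr (_ \in q).
  by rewrite -frac1; apply: frac_eq; rewrite expr0 mul1r mulr1.
Qed.

Lemma shift_XexpM P g n :
  shift 1 \notin P -> (shift (fpsX ^+ n * g) \in P) = (shift g \in P).
Proof.
move=> nPX; elim: n => [|n IHn]; first by rewrite expr0 mul1r.
rewrite exprS -mulrA -{}IHn; set h := _ * g.
by rewrite -[fpsX * h]/(val (shift h)) -shift1M prime_idealrM (negPf nPX).
Qed.

Lemma loc_extension_ex P : shift 1 \notin P -> exists q, loc_contraction P q.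
Proof.
move=> nPX; pose I (y : L) := shift (repr y).1 \in P.
(* [I] looks at a chosen representative; the choice is harmless because powers of X cancel modulo a
   prime avoiding X. *)
have IE g n : I (frac g n) = (shift g \in P).
  have : frac (repr (frac g n)).1 (repr (frac g n)).2 = frac g n.
    by rewrite -surjective_pairing reprK.
  rewrite /I; case: (repr _) => h m /= /eqP/loc_eqP[k] /(congr1 shift).
  by move=> /(congr1 (fun f => f \in P)); rewrite !shift_XexpM.
have [||||q qE] := @prime_idealr_of_pred L I.
- by rewrite -(frac0 0) IE shift0 rpred0.
- by rewrite -frac1 IE; apply: negPf.
- elim/quotW => -[h k]; elim/quotW => -[g n]; elim/quotW => -[g' n'].
    rewrite fracM fracD !IE => Pg Pg'.
    rewrite shiftD rpredD ?shift_XexpM //.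
    (* (Xh)(Xg) = X(Xhg) is in [P] and X is not, so Xhg is. *)
    have := idealMr (shift h) Pg; rewrite shiftM prime_idealrM.
    by rewrite (negPf nPX).
- elim/quotW => -[g n]; elim/quotW => -[g' n'].
  rewrite fracM !IE -prime_idealrM shiftM prime_idealrM => ->.
  exact: orbT.
- by exists q => g n; rewrite qE; apply: IE.
Qed.

Definition fps_contraction Q P :=
  fpsX \notin Q /\ forall f, (f \in P) = (val f \in Q).

(** Inclusion is reflected because g in [Q] gives Xg in [P], hence in [Q'], where X cancels. *)
Lemma fps_contraction_subset Q Q' P P' :
  fps_contraction Q P -> fps_contraction Q' P' ->
  {subset Q <= Q'} <-> {subset P <= P'}.
Proof.
move=> [QX QP] [QX' QP']; split=> sub => [f|g]; first by rewrite QP QP'; apply: sub.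
move=> Qg; have /sub : shift g \in P by rewrite QP /= idealMr.
by rewrite QP' /= prime_idealrM (negPf QX').
Qed.

Lemma fps_contraction_ex Q : fpsX \notin Q -> exists P, fps_contraction Q P.
Proof.
move=> QX; have [||||P PE] := @prime_idealr_of_pred R (fun f => val f \in Q).
- exact: rpred0.
- exact: idealr1.
- by move=> f u v Qu Qv; rewrite rpredD ?idealMr.
- by move=> f f'; rewrite prime_idealrM.
- by exists P.
Qed.

End ConstantTermInSubring.

(** * The dimension inequalities *)

Section Dimension.
Variables (B : comNzRingType) (A : subringClosed B).
Local Notation R := (subring_of (fps_const_in A)).
Local Notation L := (fps_Xinv B).

Lemma const_chain_ex n (p : nat -> prime_idealr (subring_of A)) :
  prime_chain p n ->
  exists2 P : nat -> prime_idealr R, prime_chain P n &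
    forall i, (i <= n)%N -> const_contraction (P i) (p i).
Proof.
move=> cp; have [||||P cP PE] := @prime_chain_transfer _ _
  (fun p P => const_contraction P p) p n 0 n.
- by move=> q q' P P' Pq Pq'; apply: iff_sym; apply: const_contraction_subset.
- exact: cp.
- exact: leqnn.
- by move=> i _; apply: const_contraction_ex.
- by exists P.
Qed.

Lemma krull_dim_const_le :
  (krull_dim (subring_of A) <= krull_dim R)%E.
Proof.
apply: krull_dim_le => n p /const_chain_ex[P cP _]; exact: le_krull_dim cP.
Qed.

(** The contracted chain of B[[X]] is placed below the chain coming from A; the joining inclusion
    accounts for the 1. *)
Lemma delta_chain n (p : nat -> prime_idealr (subring_of A))
    m (C : nat -> prime_idealr {fps B}) :
  prime_chain p n -> prime_chain C m -> ~ in_VX (C m) ->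
  (addX (C m) `&` [set fpsC a | a in [set` A]] = [set 0])%classic ->
  ((n%:Z + 1 + m%:Z)%:E <= krull_dim R)%E.
Proof.
move=> /const_chain_ex[P' cP' P'E] cC nX CA.
have CX i : (i <= m)%N -> fpsX \notin C i.
  move=> im; apply/negP => Xi; apply: nX.
  by apply: (prime_chain_subset cC _ Xi); rewrite im leqnn.
have [||||P cP PE] := @prime_chain_transfer _ _ (@fps_contraction _ A) C m 0 m.
- by move=> *; apply: fps_contraction_subset.
- exact: cC.
- exact: leqnn.
- by move=> i im; apply/fps_contraction_ex/CX.
have [_ PmE] := PE m (leqnn m); have P'0E := P'E 0%N (leq0n n).
have [||Q cQ] := prime_chain_cat cP cP'.
(* The constant term of [f] differs from [f] by a multiple of X, so it lies in the sum of [C m] and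
   XB[[X]], which meets A in 0. *)
- move=> f; rewrite PmE P'0E => Cf; suff -> : const_term f = 0 by rewrite rpred0.
  apply: val_inj => /=; have [g fE] := shift_const_term f.
  have : ([set 0] : set {fps B})%classic (fpsC (val (const_term f))).
    rewrite -CA; split; last by exists (val (const_term f)) => //; apply: valP.
    exists (val f); first exact: Cf.
    exists (- g) => //; rewrite {1}fE mulrN -[fpsX * g]/(val (shift A g)).
    exact: addrK.
  by move/fpsP/(_ 0%N).
(* X witnesses strictness. *)
- move=> /(_ (shift A 1)); rewrite P'0E const_term_shift rpred0 PmE /= mulr1.
  by move/(_ isT); apply/negP/CX.
- have := le_krull_dim cQ.
  by rewrite (_ : (m + n).+1%:Z = n%:Z + 1 + m%:Z) //; lia.
Qed.

Lemma krull_dim_delta_le :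
  (krull_dim (subring_of A) + 1 + delta'' A <= krull_dim R)%E.
Proof.
have := krull_dim_ge0 R; have := krull_dim_const_le.
have := @delta_chain; case: (krull_dim R) => [d| |//]; last by move=> *; rewrite leey.
(* For an empty set the convention -1 cancels the 1, leaving dim A <= dim R. *)
move=> chain dimA _; rewrite /delta''; case: ifPn => [_|/set0P[h0 Sh0]].
  by move: dimA; case: (krull_dim _) => // a; rewrite -!EFinD addrK.
(* The two suprema are bounded one at a time: first all heights for a fixed chain of A, then the
   lengths of such chains. *)
have delta_le n (p : nat -> prime_idealr (subring_of A)) : prime_chain p n ->
    (supremum -oo%E (delta''_set A) <= (d - 1 - n%:Z)%:E)%E.
  move=> cp; apply: supremum_ereal_int_le => _ [Q [nX QA ->]].
  apply: supremum_ereal_int_le => _ [m [C cC CQ] <-].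
  have := chain n p m C cp cC.
  have -> : addX (C m) = addX Q.
    apply/seteqP; split=> f [q Qq [g _ <-]]; exists q; rewrite ?inE //=.
    - by rewrite -CQ.
    - by exists g.
    - by rewrite CQ.
    - by exists g.
  rewrite /in_VX CQ => /(_ nX QA); rewrite !lee_fin; lia.
(* A chain of length 0 suffices to exclude the value +oo for the supremum of heights. *)
have [p0 _] := exists_prime_idealr (subring_of A).
have := delta_le 0%N (fun=> p0) (@prime_chain0 _ _).
move: delta_le; case: (supremum _ _) => [t| |] // delta_le _.
- have : (krull_dim (subring_of A) <= (d - 1 - t)%:E)%E.
    apply: krull_dim_le => n p /delta_le; rewrite !lee_fin; lia.
  case: (krull_dim _) => [a|//|_]; last by rewrite leNye.
  by rewrite -!EFinD !lee_fin; lia.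
- by rewrite addeNy leNye.
Qed.

Lemma krull_dim_loc_le : (1 + krull_dim L <= krull_dim R)%E.
Proof.
(* Bounding each chain separately lets the 1 be moved across once dim R is known to be finite. *)
suff : (forall n (q : nat -> prime_idealr L), prime_chain q n ->
    (n.+1%:Z%:E <= krull_dim R)%E).
  have := krull_dim_ge0 R; case: (krull_dim R) => [d| |//] _ chain.
    have : (krull_dim L <= (d - 1)%:E)%E.
      by apply: krull_dim_le => n q /chain; rewrite !lee_fin; lia.
    case: (krull_dim L) => [l|//|_]; last by rewrite leNye.
    by rewrite -!EFinD !lee_fin; lia.
  by rewrite leey.
move=> n q cq; have [||||P cP PE] := @prime_chain_transfer _ _
  (fun q P => @loc_contraction _ A P q) q n 0 n.
- by move=> *; apply: iff_sym; apply: loc_contraction_subset.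
- exact: cq.
- exact: leqnn.
- by move=> i _; apply: loc_contraction_ex.
have nPX : shift A 1 \notin P n.
  by rewrite -(PE n (leqnn n) 1 0%N) frac1 idealr1.
pose J : set (subring_of A) := [set a | exists2 f, f \in P n & const_term f = a]%classic.
have [|||p Jp] := @exists_prime_idealr_sub _ J.
- by exists 0; [exact: rpred0|exact: val_inj].
(* An element of P n with constant term 1 would be a unit of A + XB[[X]]. *)
- case=> f Pf f1; have [g fE] := shift_const_term f.
  have [h hE] := fps_subXM_inv (- g).
  have fh : val f * h = 1.
    by rewrite fE f1 const_fps1 -hE mulrN opprK.
  (* The inverse [h] is given in B[[X]]; writing X = f(Xh), with Xh in A + XB[[X]], forces X into
     [P n]. *)
  move: nPX; rewrite -fh -shiftMl mulrC.
  by rewrite idealMr.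
- move=> a _ _ [f Pf <-] [f' Pf' <-]; exists (const_fps a * f + f').
    by rewrite rpredD ?idealMr.
  by rewrite const_termD const_termM const_fpsK.
have [M ME] := const_contraction_ex p.
have [||P' cP'] := prime_chain_cat cP (@prime_chain0 _ (fun=> M)).
- by move=> f Pf; rewrite ME; apply: Jp; exists f.
- by move=> /(_ (shift A 1)); rewrite ME const_term_shift rpred0 => /(_ isT); apply/negP.
- by have := le_krull_dim cP'; rewrite addn0.
Qed.

Lemma krull_dim_le_const_add_loc :
  (krull_dim R <= 1 + krull_dim (subring_of A) + krull_dim L)%E.
Proof.
apply: krull_dim_le => n P cP.
(* The least such [m] is the index of the first prime of the chain containing X, or n + 1 if there
   is none. *)
have exm : exists m, (n < m)%N || (shift A 1 \in P m) by exists n.+1; rewrite leqnn.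
have [m mX min_m] := ex_minnP exm.
have dimL i : (i < m)%N -> (i%:Z%:E <= krull_dim L)%E.
  move=> im; have nX j : (j < m)%N -> shift A 1 \notin P j /\ (j <= n)%N.
    move=> jm; have := contraNN (min_m j); rewrite -ltnNge => /(_ jm).
    by rewrite negb_or -leqNgt => /andP[].
  have [||||q cq _] := @prime_chain_transfer _ _ (@loc_contraction _ A) P n 0 i.
  - exact: loc_contraction_subset.
  - exact: cP.
  - by case: (nX _ im).
  - by move=> j ji; apply: loc_extension_ex; case: (nX j (leq_ltn_trans ji im)).
  exact: le_krull_dim cq.
have dimA : (m <= n)%N -> ((n - m)%N%:Z%:E <= krull_dim (subring_of A))%E.
  move=> mn; move: mX; rewrite ltnNge mn /= => mX.
  have [||||p cp _] := @prime_chain_transfer _ _ (@const_contraction _ A) P n m (n - m).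
  - exact: const_contraction_subset.
  - exact: cP.
  - by rewrite subnKC.
  - move=> i; rewrite subnKC // => min; apply: const_extension_ex.
    exact: (prime_chain_subset cP min).
  exact: le_krull_dim cp.
have [mn|nm] := leqP m n; last first.
  apply: (le_trans (dimL n nm)); rewrite -[leLHS]add0e leeD2r //.
  by rewrite adde_ge0 ?krull_dim_ge0.
have {}dimA := dimA mn.
(* For m = 0 every prime of the chain contains X, and dim A alone bounds n. *)
case: m mn dimL dimA {mX min_m} => [|m] mn dimL dimA.
  rewrite subn0 in dimA; apply: (le_trans dimA).
  by rewrite -[leLHS]adde0 leeD ?krull_dim_ge0 // -[leLHS]add0e leeD2r.
(* The primes up to index [m] avoid X, those from [m.+1] on contain it, and the 1 is the step
   between them. *)
have -> : n%:Z = 1 + (n - m.+1)%N%:Z + m%:Z by lia.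
by rewrite !EFinD !leeD // dimL.
Qed.

End Dimension.

Local Close Scope ring_scope.
Local Close Scope quotient_scope.
Local Open Scope ereal_scope.

Theorem corollary4p14 (B : comNzRingType) (A : subringClosed B) :
  maxe (krull_dim (subring_of A) + 1 + delta'' A)
       (1 + krull_dim (fps_Xinv B))
    <= krull_dim (subring_of (fps_const_in A))
    <= 1 + krull_dim (subring_of A) + krull_dim (fps_Xinv B).
Proof.
by rewrite ge_max krull_dim_delta_le krull_dim_loc_le krull_dim_le_const_add_loc.
Qed.
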